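(* Let $r\geq 1$, $k\geq 1$, $0\leq q<k$, $a<b$, and positive constants $D_0,\dots,D_r$ be given, and let $u_a^0,\dots,u_a^{k-1}\in\mathbb{R}$ be fixed initial values. Consider the class $\mathcal{G}^r$ and the initial-value problem (IVP) described in the context. Then there exist constants $C>0$ and $\varepsilon_0>0$, depending only on the class $\mathcal{G}^r$ (i.e. on $a,b,r,q,D_0,\dots,D_r$) and on $k$, such that for all $\varepsilon\in(0,\varepsilon_0)$: $$\mathrm{comp}^{\mathrm{rand}}(\mathcal{G}^r,\varepsilon)\geq C\left(\frac{1}{\varepsilon}\right)^{1/(r+1/2)}\quad\text{and}\quad \mathrm{comp}^{\mathrm{quant}}(\mathcal{G}^r,\varepsilon)\geq C\left(\frac{1}{\varepsilon}\right)^{1/(r+1)}.$$ In other words, $\mathrm{comp}^{\mathrm{rand}}(\mathcal{G}^r,\varepsilon)=\Omega\big((1/\varepsilon)^{1/(r+1/2)}\big)$ and $\mathrm{comp}^{\mathrm{quant}}(\mathcal{G}^r,\varepsilon)=\Omega\big((1/\varepsilon)^{1/(r+1)}\big)$, for every $k$.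
   Context: The initial-value problem (IVP) is $$u^{(k)}(x)=g\big(x,u(x),u'(x),\dots,u^{(q)}(x)\big),\quad x\in[a,b],\qquad u^{(j)}(a)=u_a^j,\ j=0,\dots,k-1,$$ with $g:[a,b]\times\mathbb{R}^{q+1}\to\mathbb{R}$. The class of right-hand sides is $$\mathcal{G}^r=\{g\in C^{(r)}([a,b]\times\mathbb{R}^{q+1}) : |\partial^j g(x,y)|\leq D_j \text{ for all } x\in[a,b],\ y\in\mathbb{R}^{q+1},\ j=0,\dots,r\},$$ where $\partial^j g$ denotes any partial derivative of order $j$ of $g$. An algorithm produces an approximation $l$ (random in the randomized and quantum settings, written $l^\omega$ with $\omega$ from a probability space) to the solution $u$ on $[a,b]$, using information about $g$. The error at $g$ is $e^\omega(A,g)=\sup_{x\in[a,b]}|u(x)-l^\omega(x)|$. - Randomized setting: information consists of values of $g$ or its partial derivatives at randomly chosen points; the error is $e^{\mathrm{rand}}(A,\mathcal{G}^r)=\sup_{g\in\mathcal{G}^r}(\mathbf{E}\,e^\omega(A,g)^2)^{1/2}$; the cost is the number of evaluations of $g$ or its partial derivatives. - Quantum setting: information is obtained by calls of a quantum query for $g$ (in the standard sense of quantum query complexity); the error is $e^{\mathrm{quant}}(A,\mathcal{G}^r)=\sup_{g\in\mathcal{G}^r}\inf\{\alpha:\mathbf{P}(e^\omega(A,g)>\alpha)\leq 1/4\}$; the cost is the number of quantum query calls. The $\varepsilon$-complexity $\mathrm{comp}(\mathcal{G}^r,\varepsilon)$ in each setting is the minimal cost of an algorithm $A$ with $e(A,\mathcal{G}^r)\leq\varepsilon$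 in that setting. *)

(* Defs.v *)
From HB Require Import structures.
From mathcomp Require Import all_boot all_order all_algebra.
From mathcomp Require Import all_classical all_reals all_analysis.
From mathcomp Require Import measurable_realfun.
From mathcomp Require complex.

Set Implicit Arguments.
Unset Strict Implicit.
Unset Printing Implicit Defensive.

Import Order.TTheory GRing.Theory Num.Theory.
Import numFieldNormedType.Exports.
Local Open Scope classical_set_scope.
Local Open Scope ring_scope.

Section IVP.
Variable R : realType.

(* A point (x, y_0, ..., y_q) of [a,b] x R^{q+1} is a row vector of size
   q+2; coordinate 0 is x, coordinate j+1 is y_j. *)
Definition xcoord (q : nat) (z : 'rV[R]_(q.+2)) : R := z ord0 ord0.

Definition in_dom (a b : R) (q : nat) (z : 'rV[R]_(q.+2)) : Prop :=
  a <= xcoord z <= b.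

Definition evec (n : nat) (i : 'I_n) : 'rV[R]_n := \row_(j < n) (if j == i then 1 else 0).

Definition pderiv (n : nat) (i : 'I_n) (f : 'rV[R]_n -> R) : 'rV[R]_n -> R :=
  fun z => 'D_(evec i) f z.

Definition pderivs (n : nat) (s : seq 'I_n) (f : 'rV[R]_n -> R) : 'rV[R]_n -> R :=
  foldr (@pderiv n) f s.

Definition Cr (n r : nat) (g : 'rV[R]_n -> R) : Prop :=
  (forall (s : seq 'I_n) (i : 'I_n) (z : 'rV[R]_n),
      (size s < r)%N -> derivable (pderivs s g) z (evec i)) /\
  (forall s : seq 'I_n, (size s <= r)%N -> continuous (pderivs s g)).

Definition classG (a b : R) (r q : nat) (D : nat -> R) (g : 'rV[R]_(q.+2) -> R) : Prop :=
  Cr r g /\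
  forall (s : seq 'I_(q.+2)) (z : 'rV[R]_(q.+2)),
    (size s <= r)%N -> in_dom a b z -> `|pderivs s g z| <= D (size s).

Definition jet (q : nat) (u : R -> R) (x : R) : 'rV[R]_(q.+2) :=
  \row_(i < q.+2) (if (i : nat) is j.+1 then derive1n j u x else x).

Definition is_solution (a b : R) (k q : nat) (ua : nat -> R)
    (g : 'rV[R]_(q.+2) -> R) (u : R -> R) : Prop :=
  (forall j x, (j < k)%N -> a <= x <= b -> derivable (derive1n j u) x 1) /\
  (forall x, a <= x <= b -> derive1n k u x = g (jet q u x)) /\
  (forall j, (j < k)%N -> derive1n j u a = ua j).

Definition sup_err (a b : R) (u l : R -> R) : \bar R :=
  ereal_sup [set (`|u x - l x|)%:E | x in [set x | a <= x <= b]].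

(* A deterministic adaptive algorithm: given the values y_1..y_i already
   computed, it chooses the next information functional (a partial derivative
   of g, given by a list of variables of length <= r, and a point of
   [a,b] x R^{q+1}); after n steps it outputs a function on [a,b]. *)
Record det_alg (q : nat) := DetAlg {
  dnode : seq R -> seq 'I_(q.+2) * 'rV[R]_(q.+2);
  dout  : seq R -> (R -> R) }.

Fixpoint info (q : nat) (A : det_alg q) (g : 'rV[R]_(q.+2) -> R) (n : nat) : seq R :=
  if n is n'.+1 then
    let ys := info A g n' in
    rcons ys (pderivs (dnode A ys).1 g (dnode A ys).2)
  else [::].

Definition det_output (q : nat) (A : det_alg q) (g : 'rV[R]_(q.+2) -> R) (n : nat) : R -> R :=
  dout A (info A g n).

Definition det_admissible (a b : R) (r q : nat) (A : det_alg q) : Prop :=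
  forall ys, (size (dnode A ys).1 <= r)%N /\ in_dom a b (dnode A ys).2.

Definition rand_error_le (d : measure_display) (Omega : measurableType d)
    (P : probability Omega R) (a b : R) (k r q : nat) (D : nat -> R)
    (ua : nat -> R) (n : nat) (A : Omega -> det_alg q) (eps : R) : Prop :=
  forall g u, classG a b r D g -> is_solution a b k ua g u ->
    let e := fun w => sup_err a b u (det_output (A w) g n) in
    measurable_fun [set: Omega] e /\
    (\int[P]_(w in setT) (e w * e w) <= (eps ^+ 2)%:E)%E.

Local Open Scope complex_scope.
Import complex.

Definition cconj (z : R[i]) : R[i] := Complex (Re z) (- Im z).
Definition sqmod (z : R[i]) : R := Re z ^+ 2 + Im z ^+ 2.

Definition unitary (N : nat) (U : 'M[R[i]]_N) : Prop :=
  (map_mx cconj U)^T *m U = 1%:M.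

(* A quantum query for g: (m, m', m'', Z, tau, beta) with m' + m'' <= m,
   Z a nonempty subset of {0,...,2^m' - 1}, tau : Z -> [a,b] x R^{q+1},
   beta : R -> {0,...,2^m'' - 1}.  Basis states |l>, l < 2^m, are identified
   with |i>|x>|y>, l = i + 2^m' (x + 2^m'' y). *)
Record quantum_query (q : nat) := QQuery {
  qm : nat; qm1 : nat; qm2 : nat;
  qZ : pred nat;
  qtau : nat -> 'rV[R]_(q.+2);
  qbeta : R -> nat }.

Definition query_ok (a b : R) (q : nat) (Q : quantum_query q) : Prop :=
  (qm1 Q + qm2 Q <= qm Q)%N /\
  (exists i, (i < 2 ^ qm1 Q)%N /\ qZ Q i) /\
  (forall i, (i < 2 ^ qm1 Q)%N -> qZ Q i -> in_dom a b (qtau Q i)) /\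
  (forall t : R, (qbeta Q t < 2 ^ qm2 Q)%N).

(* the classical permutation  |i>|x>|y> |-> |i>|x (+) beta(g(tau i))>|y> *)
Definition query_perm (q : nat) (Q : quantum_query q) (g : 'rV[R]_(q.+2) -> R)
    (l : nat) : nat :=
  let M1 := (2 ^ qm1 Q)%N in let M2 := (2 ^ qm2 Q)%N in
  let i := (l %% M1)%N in let x := ((l %/ M1) %% M2)%N in
  let y := (l %/ (M1 * M2))%N in
  let x' := if qZ Q i then ((x + qbeta Q (g (qtau Q i))) %% M2)%N else x in
  (i + M1 * (x' + M2 * y))%N.

Definition query_mx (q : nat) (Q : quantum_query q) (g : 'rV[R]_(q.+2) -> R)
    : 'M[R[i]]_(2 ^ qm Q) :=
  \matrix_(l', l) (if (val l' == query_perm Q g (val l))%N then 1 else 0).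

Record quantum_alg (q : nat) := QAlg {
  qquery : quantum_query q;
  qU : nat -> 'M[R[i]]_(2 ^ qm qquery);
  qphi : nat -> (R -> R) }.

Definition qalg_ok (a b : R) (q : nat) (n : nat) (A : quantum_alg q) : Prop :=
  query_ok a b (qquery A) /\ forall j, (j <= n)%N -> unitary (qU A j).

Fixpoint qop (q : nat) (A : quantum_alg q) (g : 'rV[R]_(q.+2) -> R) (j : nat)
    : 'M[R[i]]_(2 ^ qm (qquery A)) :=
  if j is j'.+1 then qU A j'.+1 *m query_mx (qquery A) g *m qop A g j'
  else qU A 0.

(* probability of measuring basis state l in A_g |0> *)
Definition qprob (q : nat) (A : quantum_alg q) (g : 'rV[R]_(q.+2) -> R) (n : nat)
    (l : 'I_(2 ^ qm (qquery A))) : R :=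
  sqmod (\sum_(l0 < 2 ^ qm (qquery A) | val l0 == 0%N) qop A g n l l0).

Definition qprob_err_gt (a b : R) (q : nat) (A : quantum_alg q)
    (g : 'rV[R]_(q.+2) -> R) (n : nat) (u : R -> R) (alpha : R) : R :=
  \sum_(l < 2 ^ qm (qquery A) | (sup_err a b u (qphi A (val l)) > alpha%:E)%E)
     @qprob q A g n l.

Definition qerr (a b : R) (q : nat) (A : quantum_alg q) (g : 'rV[R]_(q.+2) -> R)
    (n : nat) (u : R -> R) : \bar R :=
  ereal_inf [set alpha%:E | alpha in [set alpha : R |
                 qprob_err_gt a b A g n u alpha <= 4^-1]].

Definition quant_error_le (a b : R) (k r q : nat) (D : nat -> R)
    (ua : nat -> R) (n : nat) (A : quantum_alg q) (eps : R) : Prop :=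
  forall g u, classG a b r D g -> is_solution a b k ua g u ->
    (qerr a b A g n u <= eps%:E)%E.

End IVP.

(* Main.v *)
(** Right-hand sides depending on [x] only already give the lower bounds: then [u] is a [k]-fold
    antiderivative, and the problem contains that of computing [u b].  Place [N] disjoint B-spline
    bumps in the left half of [[a, b]], scaled by [N^-r] so that any choice of signs gives an
    element of the class; the [i]-th bump contributes [+- c i] to [u b], with [c i >= c0 N^-(r+1)],
    and an evaluation of [g] or of a derivative reveals at most one sign.

    Randomized setting: averaging over all signs, the [N - n] signs not revealed contribute
    independently to the variance, so the mean square error is at least [(N - n) c0^2 N^-(2r+2)].

    Quantum setting: an error below half of [min c i] distinguishes any two sign vectors that differ
    in one place.  By the adversary method, summing the inner products of the states over all
    edges of the hypercube, one query lowers the sum by at most [2 * 2^N], while it has to drop from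
    [2^N * N] to at most [7/8 * 2^N * N]; hence [N <= 16 n].  In both settings [N = 16 (n + 1)]
    gives the result. *)

Require Import Defs.
From HB Require Import structures.
From mathcomp Require Import all_boot all_order all_algebra.
From mathcomp Require Import all_classical all_reals all_analysis.
From mathcomp Require Import measurable_realfun.
From mathcomp Require Import ring lra zify.

Import Order.TTheory GRing.Theory Num.Theory.
Local Open Scope ring_scope.
Import numFieldNormedType.Exports.

(** * Truncated powers and B-splines *)

Section TruncatedPowers.
Local Open Scope classical_set_scope.
Local Open Scope ring_scope.
Context {R : realType}.
Implicit Types (f g : R -> R) (x y h : R) (m n M : nat).

(** Divided powers: differentiation merely lowers the index, and the binomial theorem [dpowD] has no
    coefficients. *)
Definition dpow n x : R := x ^+ n / n`!%:R.
(** At index 0 this is the constant 1 and not a step function, and index 1 has a corner at 0. Hence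
    derivatives are taken from index 2 on, and vanishing on the left holds from index 1 on. *)
Definition tpow n x : R := dpow n (Num.max x 0).

Lemma dpow_ge0 n x : 0 <= x -> 0 <= dpow n x.
Proof. by move=> x0; rewrite divr_ge0 ?exprn_ge0. Qed.

Lemma dpow_mono n x y : 0 <= x -> x <= y -> dpow n x <= dpow n y.
Proof.
move=> x0 xy; rewrite ler_pM2r ?invr_gt0 ?ltr0n ?fact_gt0//.
by rewrite lerXn2r// nnegrE// (le_trans x0).
Qed.

Lemma dpow_leX n x : 0 <= x -> dpow n x <= x ^+ n.
Proof.
move=> x0; rewrite ler_pdivrMr ?ltr0n ?fact_gt0// ler_peMr ?exprn_ge0//.
by rewrite ler1n fact_gt0.
Qed.

Lemma dpowD n x y : dpow n (x + y) = \sum_(i < n.+1) dpow i x * dpow (n - i) y.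
Proof.
rewrite /dpow addrC exprDn mulr_suml; apply: eq_bigr => i _.
have le_in : (i <= n)%N by rewrite -ltnS.
have -> : n`!%:R = 'C(n, i)%:R * (i`!%:R * (n - i)`!%:R) :> R.
  by rewrite -!natrM bin_fact.
have neF j : j`!%:R != 0 :> R by rewrite pnatr_eq0 -lt0n fact_gt0.
have neC : 'C(n, i)%:R != 0 :> R by rewrite pnatr_eq0 -lt0n bin_gt0.
by rewrite -[_ *+ _]mulr_natl; field; rewrite !neF neC.
Qed.

Lemma is_derive_dpow n x : is_derive x 1 (dpow n.+1) (dpow n x).
Proof.
have neF : n`!%:R != 0 :> R by rewrite pnatr_eq0 -lt0n fact_gt0.
have -> : dpow n.+1 = (n.+1)`!%:R^-1 \*: ((@id R) ^+ n.+1).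
  by apply/funext => y; rewrite /dpow /= mulrC fctE.
apply: is_derive_eq; rewrite /dpow /= factS natrM /GRing.scale /=.
have neS : n.+1%:R != 0 :> R by rewrite pnatr_eq0.
by move: n`!%:R n.+1%:R neF neS => F S neF neS; field; rewrite neF neS.
Qed.

(* The quadratic error bound settles the corner at 0 together with the two smooth sides. *)
Lemma is_derive_sqr_maxr0 x :
  is_derive x 1 (fun y : R => Num.max y 0 ^+ 2) (2 * Num.max x 0).
Proof.
pose e (t : R) := t^-1 *: (Num.max (t *: 1 + x) 0 ^+ 2 - Num.max x 0 ^+ 2).
suff ecvg : e @ 0^' --> 2 * Num.max x 0.
  apply: DeriveDef; first by apply/cvg_ex; exists (2 * Num.max x 0).
  exact: cvg_lim ecvg.
apply/cvgrPdist_le => eps eps0; near=> t.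
have t0 : t != 0 by near: t; exact: nbhs_dnbhs_neq.
have te : `|t| <= eps.
  near: t; exact: dnbhs0_le.
apply: le_trans te; rewrite /e.
have -> : 2 * Num.max x 0 - t^-1 *: (Num.max (t *: 1 + x) 0 ^+ 2 - Num.max x 0 ^+ 2)
  = (2 * t * Num.max x 0 - (Num.max (t + x) 0 ^+ 2 - Num.max x 0 ^+ 2)) / t.
  by rewrite /GRing.scale /= mulr1; field.
rewrite normrM normfV ler_pdivrMr ?normr_gt0// -normrM.
rewrite (ger0_norm (_ : 0 <= t * t)); last by nra.
by rewrite ler_norml; case: (leP x 0) => ?; case: (leP (t + x) 0) => ?; apply/andP; split; nra.
Unshelve. all: by end_near. Qed.

(** Each truncated power is, up to a factor, [y] times the preceding one ([tpowS]), so past the base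
    case the product rule needs no further look at the corner. *)
Lemma is_derive_tpow n x : is_derive x 1 (tpow n.+2) (tpow n.+1 x).
Proof.
elim: n x => [|n IHn] x.
  have -> : tpow 2 = 2^-1 \*: (fun y : R => Num.max y 0 ^+ 2).
    by apply/funext => y; rewrite /tpow /dpow /= mulrC.
  have := is_derive_sqr_maxr0 x => dsq.
  apply: is_derive_eq; rewrite /tpow /dpow /GRing.scale /= expr1 invr1; by field.
have neF : n`!%:R != 0 :> R by rewrite pnatr_eq0 -lt0n fact_gt0.
have tpowS m y : tpow m.+2 y = m.+2%:R^-1 * (y * tpow m.+1 y).
  have neFm : (m.+1)`!%:R != 0 :> R by rewrite pnatr_eq0 -lt0n fact_gt0.
  rewrite /tpow /dpow factS natrM; case: (leP y 0) => ?; rewrite ?expr0n /= ?(mul0r, mulr0)//.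
  have neS : m.+2%:R != 0 :> R by rewrite pnatr_eq0.
  by move: _%:R m.+2%:R neFm neS => F S neF' neS; rewrite exprS; field; rewrite neF' neS.
have -> : tpow n.+3 = n.+3%:R^-1 \*: ((@id R) * tpow n.+2).
  by apply/funext => y; rewrite tpowS.
apply: is_derive_eq; rewrite /GRing.scale /= mulr1 !tpowS.
have := tpow n.+1 x => t.
have n0 := ler0n R n; have [n2 n3] : n.+2%:R != 0 :> R /\ n.+3%:R != 0 :> R by rewrite !pnatr_eq0.
rewrite -(natr1 n.+2) in n3 *; move: n.+2%:R n2 n3 => c c0 c1.
by field; rewrite c0 c1.
Qed.


Lemma continuous_tpow n : continuous (tpow n).
Proof.
move=> x; rewrite /tpow /dpow; apply: cvgM; last exact: cvg_cst.
have cmax : {for x, continuous (fun y : R => Num.max y 0)}.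
  by apply: (@continuous_max _ _ id (cst 0) x); [exact: cvg_id | exact: cvg_cst].
exact: (continuous_comp cmax (@exprn_continuous R n _)).
Qed.

(** * Iterated forward differences *)

Definition fdiff h f x : R := f (x + h) - f x.

Lemma is_derive_fdiff h f f' : (forall x, is_derive x 1 f (f' x)) ->
  forall x, is_derive x 1 (fdiff h f) (fdiff h f' x).
Proof.
move=> df x; have dfs : is_derive x 1 (f \o (+%R^~ h)) (f' (x + h)).
  have dsh : is_derive x (1 : R) (shift h) 1 by exact: is_derive_shift.
  by have := @is_derive1_comp _ f (shift h) x _ _ (df (x + h)) dsh; rewrite mulr1.
exact: is_deriveB.
Qed.

Lemma is_derive_iter_fdiff h m f f' : (forall x, is_derive x 1 f (f' x)) ->
  forall x, is_derive x 1 (iter m (fdiff h) f) (iter m (fdiff h) f' x).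
Proof. by move=> df; elim: m => //= m IHm; exact: is_derive_fdiff. Qed.

Lemma continuous_iter_fdiff h m f :
  continuous f -> continuous (iter m (fdiff h) f).
Proof.
move=> cf; elim: m => //= m IHm x; apply: cvgB; last exact: IHm.
have cshift : {for x, continuous (shift h)}.
  by apply: cvgD; [exact: cvg_id | exact: cvg_cst].
exact: (continuous_comp cshift (IHm _)).
Qed.

Lemma eq_iter_fdiff_right h m f g t : 0 <= h -> (forall x, t <= x -> f x = g x) ->
  forall x, t <= x -> iter m (fdiff h) f x = iter m (fdiff h) g x.
Proof.
move=> h0 fg; elim: m => //= m IHm x tx.
by rewrite /fdiff !IHm// (le_trans tx)// lerDl.
Qed.

(** Each difference at most doubles a bound, and [m] of them look at most [m%:R * h] to the
    right. *)
Lemma iter_fdiff_bound h m f t B : 0 <= h -> (forall x, x <= t -> `|f x| <= B) ->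
  forall x, x <= t - m%:R * h -> `|iter m (fdiff h) f x| <= 2 ^+ m * B.
Proof.
move=> h0 fB; elim: m => [|m IHm] x.
  by rewrite mul0r subr0 mul1r; exact: fB.
rewrite -natr1 mulrDl mul1r => xt; rewrite iterS /fdiff exprS -mulrA mulr_natl mulr2n.
by apply: le_trans (ler_normB _ _) _; apply: lerD; apply: IHm; lra.
Qed.

Lemma iter_fdiff_sum h m n (c : 'I_n -> R) (F : 'I_n -> R -> R) x :
  iter m (fdiff h) (fun y => \sum_(i < n) c i * F i y) x =
  \sum_(i < n) c i * iter m (fdiff h) (F i) x.
Proof.
elim: m x => //= m IHm x; rewrite /fdiff !IHm -sumrB.
by apply: eq_bigr => i _; rewrite mulrBr.
Qed.

(** One difference, expanded by [dpowD], cancels the top degree and leaves lower ones with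
    coefficients that are nonnegative for [0 <= h]. The next three lemmas are inductions along this
    recursion. *)
Lemma iter_fdiff_dpowS h m M x : iter m.+1 (fdiff h) (dpow M) x =
  \sum_(i < M) dpow (M - i) h * iter m (fdiff h) (dpow i) x.
Proof.
rewrite iterSr -iter_fdiff_sum; congr (iter _ _ _ x); apply/funext => y.
rewrite /fdiff dpowD big_ord_recr /= subnn /dpow expr0 fact0 divr1 mulr1 addrK.
by apply: eq_bigr => i _; rewrite mulrC.
Qed.

Lemma iter_fdiff_dpow_eq0 h m M x : (M < m)%N -> iter m (fdiff h) (dpow M) x = 0.
Proof.
elim: m M x => // m IHm M x Mm; rewrite iter_fdiff_dpowS big1// => i _.
by rewrite IHm ?mulr0//; exact: leq_trans (ltn_ord i) Mm.
Qed.

Lemma iter_fdiff_dpow_ge0 h m M x : 0 <= h -> 0 <= x -> 0 <= iter m (fdiff h) (dpow M) x.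
Proof.
move=> h0 x0; elim: m M => [|m IHm] M; first exact: dpow_ge0.
by rewrite iter_fdiff_dpowS sumr_ge0// => i _; rewrite mulr_ge0 ?dpow_ge0.
Qed.

(** Of the recursion only the highest remaining degree is kept; its coefficient is [h], and all
    other terms are nonnegative. *)
Lemma iter_fdiff_dpow_ge h m M x : 0 <= h -> 0 <= x -> (m <= M)%N ->
  h ^+ m * dpow (M - m) x <= iter m (fdiff h) (dpow M) x.
Proof.
move=> h0 x0; elim: m M => [|m IHm] [|M]; rewrite ?subn0 ?mul1r// ltnS => mM.
rewrite iter_fdiff_dpowS big_ord_recr /= (subSn (leqnn M)) subnn [dpow 1 h]/dpow expr1 divr1.
rewrite exprS -mulrA subSS; apply: ler_wpDl; last by rewrite ler_wpM2l// IHm.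
by rewrite sumr_ge0// => i _; rewrite mulr_ge0 ?dpow_ge0 ?iter_fdiff_dpow_ge0.
Qed.

(* Up to normalization, the B-spline of order m for M = m - 1; M < m gives
   its derivatives, M >= m its iterated antiderivatives. *)
Definition spline h m M : R -> R := iter m (fdiff h) (tpow M).

Lemma is_derive_spline h m M x :
  is_derive x 1 (spline h m M.+2) (spline h m M.+1 x).
Proof. by apply: is_derive_iter_fdiff; exact: is_derive_tpow. Qed.

Lemma continuous_spline h m M : continuous (spline h m M).
Proof. exact/continuous_iter_fdiff/continuous_tpow. Qed.

(** Every point entering the differences is at most 0, where truncated powers of positive index
    vanish. *)
Lemma spline_left h m M x : 0 <= h -> x <= - (m%:R * h) -> spline h m M.+1 x = 0.
Proof.
move=> h0 xh; apply/eqP; rewrite -normr_le0 -(mulr0 (2 ^+ m)).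
apply: (@iter_fdiff_bound h m _ 0) => //; last by rewrite sub0r.
by move=> y y0; rewrite /tpow /dpow max_r// expr0n mul0r normr0.
Qed.

Lemma spline_right h m M x : 0 <= h -> 0 <= x ->
  spline h m M x = iter m (fdiff h) (dpow M) x.
Proof.
move=> h0; apply: eq_iter_fdiff_right => // y y0; by rewrite /tpow max_l.
Qed.

Lemma spline_right_eq0 h m M x : 0 <= h -> (M < m)%N -> 0 <= x -> spline h m M x = 0.
Proof. by move=> h0 Mm x0; rewrite spline_right// iter_fdiff_dpow_eq0. Qed.

Lemma spline_right_ge h m M x : 0 <= h -> (m <= M)%N -> 0 <= x ->
  h ^+ m * dpow (M - m) x <= spline h m M x.
Proof. by move=> h0 mM x0; rewrite spline_right// iter_fdiff_dpow_ge. Qed.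

(** To the right of 0 the differences annihilate a polynomial of degree below [m]; to the left they
    see only points up to [m%:R * h]. *)
Lemma spline_bound h m M x : 0 <= h -> (M < m)%N ->
  `|spline h m M x| <= 2 ^+ m * (m%:R * h) ^+ M.
Proof.
move=> h0 Mm; have mh0 : 0 <= m%:R * h by rewrite mulr_ge0.
have [x0|/ltW x0] := leP 0 x.
  by rewrite spline_right_eq0// normr0 mulr_ge0 ?exprn_ge0.
apply: (@iter_fdiff_bound h m _ (m%:R * h)) => //; last by rewrite subrr.
move=> y yh; have my0 : 0 <= Num.max y 0 by rewrite le_max lexx orbT.
rewrite ger0_norm; last exact: dpow_ge0.
apply: (le_trans (dpow_leX M _ my0)).
by rewrite lerXn2r// ?nnegrE// ge_max yh.
Qed.

End TruncatedPowers.

Arguments spline : simpl never.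
(** * Sign-indexed families in the class *)

Section HardInstances.
Import numFieldNormedType.Exports.
Local Open Scope classical_set_scope.
Local Open Scope ring_scope.
Context {R : realType}.

Lemma is_derive_xcoord q (f : R -> R) (z : 'rV[R]_q.+2) (d : R) (i : 'I_q.+2) :
  is_derive (xcoord z) 1 f d ->
  is_derive z (evec R i) (fun z => f (xcoord z)) (if i == ord0 then d else 0).
Proof.
move=> [df dE].
pose e (h : R) := h^-1 *: (((fun z => f (xcoord z)) \o shift z) (h *: evec R i) - f (xcoord z)).
suff ecvg : e @ 0^' --> (if i == ord0 then d else 0).
  apply: DeriveDef; first by apply/cvg_ex; eexists; exact: ecvg.
  exact: cvg_lim ecvg.
have [i0|i0] := eqVneq i ord0.
  rewrite -dE /derive; have -> // : e =
    (fun h => h^-1 *: ((f \o shift (xcoord z)) (h *: (1 : R)) - f (xcoord z))).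
  by apply/funext => h; rewrite /e i0 /= /xcoord !mxE.
have -> : e = cst 0; last exact: cvg_cst.
apply/funext => h; rewrite /e /= /xcoord !mxE eq_sym (negPf i0).
by rewrite mulr0 add0r subrr scaler0.
Qed.

(** [F] lists a function of [x] with its successive derivatives; a mixed partial derivative survives
    only if every variable in [s] is [x]. *)
Lemma pderivs_xcoord q r (F : nat -> R -> R) (s : seq 'I_q.+2) :
  (forall j (x : R), (j < r)%N -> is_derive x 1 (F j) (F j.+1 x)) -> (size s <= r)%N ->
  pderivs s (fun z => F 0%N (xcoord z)) =
  (fun z => if all (pred1 ord0) s then F (size s) (xcoord z) else 0).
Proof.
move=> dF; elim: s => [//|i s IHs] sr; rewrite /= IHs; last exact: ltnW.
apply/funext => z; rewrite /pderiv; case: (all _ s).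
  have := @is_derive_xcoord q (F (size s)) z _ i (dF _ _ sr) => dz.
  by rewrite derive_val andbT.
by rewrite andbF; exact: derive_val.
Qed.

Lemma Cr_xcoord q r (F : nat -> R -> R) :
  (forall j (x : R), (j < r)%N -> is_derive x 1 (F j) (F j.+1 x)) ->
  (forall j, (j <= r)%N -> continuous (F j)) ->
  Cr r (fun z : 'rV[R]_q.+2 => F 0%N (xcoord z)).
Proof.
move=> dF cF; split=> [s i z sr|s sr].
  rewrite (pderivs_xcoord _ _ _ _ dF (ltnW sr)); case: (all _ s); last exact: ex_derive.
  exact: (@ex_derive _ _ _ _ _ _ _ (is_derive_xcoord q (F (size s)) z _ i (dF _ (xcoord z) sr))).
rewrite (pderivs_xcoord _ _ _ _ dF sr); case: (all _ s) => z; last exact: cst_continuous.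
exact: (continuous_comp (@coord_continuous R _ _ ord0 ord0 z) (cF _ sr _)).
Qed.

Lemma classG_xcoord q r (a b : R) (D : nat -> R) (F : nat -> R -> R) :
  (forall j (x : R), (j < r)%N -> is_derive x 1 (F j) (F j.+1 x)) ->
  (forall j, (j <= r)%N -> continuous (F j)) ->
  (forall j x, (j <= r)%N -> `|F j x| <= D j) ->
  classG a b r D (fun z : 'rV[R]_q.+2 => F 0%N (xcoord z)).
Proof.
move=> dF cF bF; split; first exact: Cr_xcoord.
move=> s z sr _; rewrite (pderivs_xcoord _ _ _ _ dF sr); case: ifP => _; first exact: bF.
(* The bound is nonnegative because it dominates a norm, here at the point 0. *)
by rewrite normr0 (le_trans _ (bF _ 0 sr)).
Qed.

(** The [j]-th derivative of the polynomial with initial values [ua] at [a]. The test [j <= l]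
    guards against truncated subtraction, since [dpow 0] is 1. *)
Definition taylor (a : R) (ua : nat -> R) k j (x : R) : R :=
  \sum_(l < k) ua l * (if (j <= l)%N then dpow (l - j) (x - a) else 0).

Lemma is_derive_taylor a ua k j (x : R) :
  is_derive x 1 (taylor a ua k j) (taylor a ua k j.+1 x).
Proof.
have -> : taylor a ua k j = \sum_(l < k)
    (ua l \*: (if (j <= l)%N then dpow (l - j) \o (shift (- a)) else cst 0)).
  by apply/funext => y; rewrite /taylor fct_sumE; apply: eq_bigr => l _; case: ifP.
apply: is_derive_sum => l; apply: is_deriveZ.
have [jl|lj|->] := ltngtP j l; first last.
- rewrite subnn; have -> : dpow 0 \o shift (- a) = cst (dpow 0 (0 : R)).
    by apply/funext => y; rewrite /= /dpow !expr0.
  exact: is_derive_cst.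
- exact: is_derive_cst.
have -> : (l - j = (l - j.+1).+1)%N by rewrite subnSK.
have dsh : is_derive x (1 : R) (shift (- a)) 1 by exact: is_derive_shift.
have := @is_derive1_comp _ (dpow (l - j.+1).+1) (shift (- a)) x _ _ (is_derive_dpow _ _) dsh.
by rewrite mulr1.
Qed.

Lemma taylor_eq0 a ua k x : taylor a ua k k x = 0.
Proof. by rewrite /taylor big1// => l _; rewrite leqNgt ltn_ord mulr0. Qed.

Lemma taylor_id a ua k j : (j < k)%N -> taylor a ua k j a = ua j.
Proof.
move=> jk; rewrite /taylor (bigD1 (Ordinal jk))//= leqnn subnn subrr.
rewrite /dpow expr0 fact0 divr1 mulr1 big1 ?addr0// => l /eqP lj.
have [jl|lj'|jl] := ltngtP j l; rewrite ?mulr0//.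
- by rewrite expr0n subn_eq0 leqNgt jl mul0r mulr0.
- by case: lj; exact/val_inj.
Qed.

(** When the right-hand side depends on [x] alone, solving the equation means prolonging it upwards
    by [k] antiderivatives, which [V] lists from [V k] to [V 0]. *)
Lemma is_solution_xcoord a b k q ua (V : nat -> R -> R) : (0 < k)%N ->
  (forall j (x : R), (j < k)%N -> is_derive x 1 (V j) (V j.+1 x)) ->
  (forall j, (j < k)%N -> V j a = ua j) ->
  is_solution a b k ua (fun z : 'rV[R]_q.+2 => V k (xcoord z)) (V 0%N).
Proof.
move=> k0 dV Va.
have dn j : (j <= k)%N -> derive1n j (V 0%N) = V j.
  elim: j => [//|j IHj] jk; rewrite derive1nS IHj; last exact: ltnW.
  by apply/funext => x; rewrite derive1E; have := dV _ x jk => dVx; exact: derive_val.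
split=> [j x jk _|]; first by rewrite dn ?(ltnW jk)//; exact: (@ex_derive _ _ _ _ _ _ _ (dV _ x jk)).
split=> [x _|j jk]; last by rewrite dn ?(ltnW jk)// Va.
by rewrite dn// /xcoord mxE.
Qed.

(** * Signed sums of disjoint bumps *)

Section Family.
Variables (r N : nat) (a b lam : R).
Hypotheses (ab : a < b) (lam0 : 0 < lam).

(** The left half of the interval is cut into [N.+1] cells of width [w]. The step [eta] makes a
    spline of order [r.+2] fill one cell, and [p i] is the right end of cell [i]. *)
Let w : R := (b - a) / (2 * N.+1%:R).
Let eta : R := w / r.+2%:R.
Let p (i : 'I_N.+1) : R := a + i.+1%:R * w.

Let w_gt0 : 0 < w. Proof. by rewrite divr_gt0 ?mulr_gt0 ?subr_gt0. Qed.
Let eta_gt0 : 0 < eta. Proof. by rewrite divr_gt0. Qed.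
Let etaE : r.+2%:R * eta = w. Proof. by rewrite /eta mulrC divfK ?pnatr_eq0. Qed.

(** Index [r.+1] is the right-hand side, lower indices are its derivatives, and [r.+1 + k] is its
    [k]-fold antiderivative. The factor [lam / w] makes the bound at index [M.+1] proportional to
    [w ^+ M]. *)
Definition bumps M (e : {ffun 'I_N.+1 -> bool}) (x : R) : R :=
  \sum_(i < N.+1) (-1) ^+ e i * (lam / w * spline eta r.+2 M (x - p i)).

Lemma is_derive_bumps M e (x : R) : is_derive x 1 (bumps M.+2 e) (bumps M.+1 e x).
Proof.
have -> : bumps M.+2 e = \sum_(i < N.+1)
    ((-1) ^+ e i \*: (lam / w \*: (spline eta r.+2 M.+2 \o shift (- p i)))).
  by apply/funext => y; rewrite fct_sumE.
apply: is_derive_sum => i; do 2 apply: is_deriveZ.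
have dsh : is_derive x (1 : R) (shift (- p i)) 1 by exact: is_derive_shift.
have := @is_derive1_comp _ (spline eta r.+2 M.+2) (shift (- p i)) x _ _ (is_derive_spline _ _ _ _) dsh.
by rewrite mulr1.
Qed.

Lemma continuous_bumps M e : continuous (bumps M e).
Proof.
have -> : bumps M e = (fun x => \sum_(i < N.+1)
  (-1) ^+ e i * (lam / w * spline eta r.+2 M (x - p i))) by [].
move=> x; apply: cvg_big => [|i _]; first exact: add_continuous.
apply: cvgMr; apply: cvgMr.
have csh : {for x, continuous (shift (- p i))}.
  by apply: cvgD; [exact: cvg_id | exact: cvg_cst].
exact: (continuous_comp csh (continuous_spline _ _ _ _)).
Qed.

(** [i0] is the cell containing [x]; if [x] is in no open cell, all bumps vanish there and any index
    will do. *)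
Lemma bumps_support x : exists i0, forall i M, (M < r.+1)%N -> i != i0 ->
  spline eta r.+2 M.+1 (x - p i) = 0.
Proof.
have supp i M : (M < r.+1)%N -> spline eta r.+2 M.+1 (x - p i) != 0 ->
    a + i%:R * w < x < a + i.+1%:R * w.
  move=> Mr; apply: contraNT; rewrite negb_and -!leNgt => /orP[xl|xr]; apply/eqP.
    by apply: (spline_left _ _ _ _ (ltW eta_gt0)); rewrite etaE /p -natr1; lra.
  by apply: (spline_right_eq0 _ _ _ _ (ltW eta_gt0)) => //; rewrite subr_ge0.
case: (pickP (fun i : 'I_N.+1 => a + i%:R * w < x < a + i.+1%:R * w)) => [i0|none].
  move=> /andP[l0 r0]; exists i0 => i M Mr; apply: contraNeq => /(supp _ _ Mr)/andP[l1 r1].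
  have: i%:R * w < i0.+1%:R * w by lra.
  have: i0%:R * w < i.+1%:R * w by lra.
  rewrite !ltr_pM2r// !ltr_nat !ltnS => ? ?.
  by apply/eqP/val_inj/eqP; rewrite eqn_leq; apply/andP.
exists ord0 => i M Mr _; apply: contraFeq (none i) => /(supp _ _ Mr); exact.
Qed.

Lemma bumps_bound M e x : (M < r.+1)%N ->
  `|bumps M.+1 e x| <= lam * 2 ^+ r.+2 * w ^+ M.
Proof.
move=> Mr; have [i0 i0P] := bumps_support x; rewrite /bumps (bigD1 i0)//= big1 ?addr0.
  have lw0 : 0 < lam / w by rewrite divr_gt0.
  rewrite normrM normr_sign mul1r normrM (ger0_norm (ltW lw0)).
  have -> : lam * 2 ^+ r.+2 * w ^+ M = lam / w * (2 ^+ r.+2 * w ^+ M.+1).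
    by rewrite (exprS w); field; rewrite gt_eqF.
  by rewrite ler_pM2l// -[X in X ^+ M.+1]etaE; apply: spline_bound (ltW eta_gt0) _.
by move=> i ii0; rewrite i0P// !mulr0.
Qed.

(** The index depends on [x] alone, not on the signs or the order of the derivative: one evaluation
    reveals one sign. *)
Lemma bumps_local x : exists i0, forall M (e e' : {ffun 'I_N.+1 -> bool}), (M < r.+1)%N -> e i0 = e' i0 ->
  bumps M.+1 e x = bumps M.+1 e' x.
Proof.
have [i0 i0P] := bumps_support x; exists i0 => M e e' Mr ee'; apply: eq_bigr => i _.
by have [->|ii0] := eqVneq i i0; [rewrite ee' | rewrite i0P// !mulr0].
Qed.

Lemma bumps_left M e : bumps M.+1 e a = 0.
Proof.
rewrite /bumps big1// => i _; rewrite (spline_left _ _ _ _ (ltW eta_gt0)) ?mulr0//.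
have iw : 0 <= i%:R * w by rewrite mulr_ge0// ltW.
by rewrite etaE /p -natr1 mulrDl mul1r; lra.
Qed.

(** All bumps end by the midpoint, so [b] is at least [(b - a) / 2] beyond them. There
    [spline_right_ge] leaves the degree [k.-1], and [eta ^+ r.+2 / w] supplies the power
    [w ^+ r.+1]. *)
Lemma bumps_weight k i : (0 < k)%N ->
  lam / r.+2%:R ^+ r.+2 * w ^+ r.+1 * dpow k.-1 ((b - a) / 2) <=
  lam / w * spline eta r.+2 (r.+1 + k) (b - p i).
Proof.
move=> k0; have -> : lam / r.+2%:R ^+ r.+2 * w ^+ r.+1 * dpow k.-1 ((b - a) / 2) =
    lam / w * (eta ^+ r.+2 * dpow k.-1 ((b - a) / 2)).
  rewrite /eta (expr_div_n w r.+2%:R) (exprS w r.+1).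
  have : r.+2%:R ^+ r.+2 != 0 :> R by rewrite expf_neq0// pnatr_eq0.
  by move: (r.+2%:R ^+ r.+2) => c c0; field; rewrite c0 gt_eqF.
rewrite (ler_pM2l (divr_gt0 lam0 w_gt0)).
have bp : (b - a) / 2 <= b - p i.
  suff: i.+1%:R * w <= (b - a) / 2 by rewrite /p; lra.
  apply: le_trans (_ : N.+1%:R * w <= _); first by rewrite ler_pM2r// ler_nat ltn_ord.
  have : N.+1%:R != 0 :> R by rewrite pnatr_eq0.
  rewrite le_eqVlt /w => N0; apply/orP; left; apply/eqP.
  by move: N.+1%:R N0 => c c0; field.
have ba0 : 0 <= (b - a) / 2 by rewrite divr_ge0// subr_ge0 ltW.
apply: le_trans (spline_right_ge _ _ _ _ (ltW eta_gt0) _ (le_trans ba0 bp)); last first.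
  by rewrite -addn1 leq_add2l.
rewrite (_ : r.+1 + k - r.+2 = k.-1)%N; last by lia.
by rewrite ler_pM2l ?exprn_gt0// dpow_mono.
Qed.

End Family.

Lemma exists_lower_bound (D : nat -> R) r : (forall j, (j <= r)%N -> 0 < D j) ->
  exists2 d, 0 < d & forall j, (j <= r)%N -> d <= D j.
Proof.
elim: r => [|r IHr] D0; first by exists (D 0%N) => [|j]; [exact: D0 | rewrite leqn0 => /eqP->].
have [j jr|d d0 dD] := IHr; first by apply: D0; exact: leqW.
exists (Num.min d (D r.+1)) => [|j]; first by rewrite lt_min d0 D0.
by rewrite leq_eqVlt ltnS ge_min => /orP[/eqP->|/dD->]; rewrite ?lexx ?orbT.
Qed.

(** All that the two lower bounds need from the construction. The constant [c0] is fixed before [N]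
    and [ua]; the initial values affect only [u] and the offset [v]. *)
Lemma hard_family r k q (a b : R) (D : nat -> R) : (0 < k)%N -> a < b ->
  (forall j, (j <= r)%N -> 0 < D j) ->
  exists2 c0 : R, 0 < c0 & forall N, exists (G : {ffun 'I_N.+1 -> bool} -> 'rV[R]_q.+2 -> R)
    (c : 'I_N.+1 -> R) (idx : 'rV[R]_q.+2 -> 'I_N.+1),
  [/\ forall e, classG a b r D (G e),
      forall ua, exists (u : {ffun 'I_N.+1 -> bool} -> R -> R) (v : R), forall e,
        is_solution a b k ua (G e) (u e) /\ u e b = v + \sum_i (-1) ^+ e i * c i,
      forall i, c0 / N.+1%:R ^+ r.+1 <= c i &
      forall (e e' : {ffun 'I_N.+1 -> bool}) s z, (size s <= r)%N -> e (idx z) = e' (idx z) ->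
        pderivs s (G e) z = pderivs s (G e') z].
Proof.
move=> k0 ab D0; have ba0 : 0 < b - a by rewrite subr_gt0.
have [d d0 dD] := exists_lower_bound _ _ D0.
(* [B] is at least 1 and at least the cell width, so [B ^+ r] dominates all powers of the width up
   to the [r]-th; [lam] then brings every derivative below [d]. *)
pose B : R := 1 + (b - a); have B1 : 1 <= B by rewrite /B; lra.
have B0 : 0 < B by lra.
pose lam := d / (2 ^+ r.+2 * B ^+ r).
have lam0 : 0 < lam by rewrite divr_gt0// mulr_gt0 ?exprn_gt0.
(* This is the bound of [bumps_weight] with the factor [N.+1%:R ^- r.+1] split off. *)
pose c0 := lam / r.+2%:R ^+ r.+2 * ((b - a) / 2) ^+ r.+1 * dpow k.-1 ((b - a) / 2).
exists c0.
  have ba2 : 0 < (b - a) / 2 by exact: divr_gt0.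
  have lr0 : 0 < lam / r.+2%:R ^+ r.+2 by rewrite divr_gt0// exprn_gt0.
  apply: mulr_gt0; first by rewrite mulr_gt0 ?exprn_gt0.
  by apply: divr_gt0; [exact: exprn_gt0 | rewrite ltr0n fact_gt0].
move=> N; pose F e j := bumps r N a b lam (r.+1 - j) e.
have dF e j (x : R) : (j < r)%N -> is_derive x 1 (F e j) (F e j.+1 x).
  move=> jr; rewrite /F; have -> : (r.+1 - j = (r - j.+1).+2)%N by lia.
  have -> : (r.+1 - j.+1 = (r - j.+1).+1)%N by lia.
  exact: is_derive_bumps.
have cF e j : (j <= r)%N -> continuous (F e j) by move=> _; exact: continuous_bumps.
exists (fun e z => F e 0%N (xcoord z)).
exists (fun i => lam / ((b - a) / (2 * N.+1%:R)) *
   spline ((b - a) / (2 * N.+1%:R) / r.+2%:R) r.+2 (r.+1 + k)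
     (b - (a + i.+1%:R * ((b - a) / (2 * N.+1%:R))))).
have /choice[idx idxP] := fun z : 'rV[R]_q.+2 => bumps_local r N a b lam ab (xcoord z).
exists idx; split.
- move=> e; apply: (classG_xcoord q r a b D (F e) (dF e) (cF e)) => j x jr.
  have -> : F e j = bumps r N a b lam (r - j).+1 e by rewrite /F subSn.
  apply: le_trans (bumps_bound _ _ _ _ _ ab lam0 _ _ _ _) _; first by lia.
  apply: le_trans (dD _ jr).
  have w0 : 0 <= (b - a) / (2 * N.+1%:R) by rewrite divr_ge0 ?ltW// mulr_gt0.
  have wB : (b - a) / (2 * N.+1%:R) <= B.
    rewrite ler_pdivrMr ?mulr_gt0//; have : 1 <= N.+1%:R :> R by rewrite ler1n.
    by move: N.+1%:R => n n1; rewrite /B; nra.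
  have wX : ((b - a) / (2 * N.+1%:R)) ^+ (r - j) <= B ^+ r.
    apply: le_trans (_ : B ^+ (r - j) <= _); last by rewrite ler_weXn2l// leq_subr.
    by rewrite lerXn2r// nnegrE ltW.
  have p2 : 0 < 2 ^+ r.+2 :> R by apply: exprn_gt0; rewrite ltr0n.
  rewrite -(mulrA lam) /lam mulrAC ler_pdivrMr; last by rewrite (mulr_gt0 p2) ?exprn_gt0.
  by rewrite (ler_pM2l d0) (ler_pM2l p2).
- move=> ua.
  (* At [j = k] the polynomial part is gone and the right-hand side remains; at [a] the bumps vanish
     and the polynomial alone gives the initial values. *)
  pose V e j (x : R) := taylor a ua k j x + bumps r N a b lam (r.+1 + k - j) e x.
  exists (fun e => V e 0%N), (taylor a ua k 0 b) => e; split; last by rewrite /V subn0.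
  have -> : (fun z : 'rV[R]_q.+2 => F e 0%N (xcoord z)) = (fun z => V e k (xcoord z)).
    by apply/funext => z; rewrite /F /V taylor_eq0 add0r subn0 addnK.
  apply: is_solution_xcoord => // j => [x jk|jk]; last first.
    by rewrite /V taylor_id// (_ : r.+1 + k - j = (r + k - j).+1)%N ?bumps_left ?addr0//; lia.
  have jk1 : (r.+1 + k - j = (r + k - j.+1).+2)%N by lia.
  have jk2 : (r.+1 + k - j.+1 = (r + k - j.+1).+1)%N by lia.
  rewrite /V jk1 jk2; apply: is_deriveD; [exact: is_derive_taylor | exact: is_derive_bumps].
- move=> i; apply: le_trans (bumps_weight _ _ _ _ _ ab lam0 _ _ k0).
  rewrite le_eqVlt; apply/orP; left; apply/eqP; rewrite /c0.
  have -> : (b - a) / (2 * N.+1%:R) = (b - a) / 2 / N.+1%:R by rewrite invfM mulrA.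
  by rewrite [in RHS]exprMn exprVn mulrAC !mulrA.
- move=> e e' s z sr ee'.
  rewrite (pderivs_xcoord _ _ _ _ (dF e) sr) (pderivs_xcoord _ _ _ _ (dF e') sr).
  case: ifP => // _; rewrite /F (_ : r.+1 - size s = (r - size s).+1)%N; last by lia.
  by apply: idxP => //; lia.
Qed.

End HardInstances.

(** * Randomized algorithms *)

Section Randomized.
Context {R : realType}.

Definition flip N (e : {ffun 'I_N -> bool}) (i : 'I_N) : {ffun 'I_N -> bool} :=
  [ffun j => if j == i then ~~ e j else e j].

Lemma flipK N (i : 'I_N) : involutive (fun e => flip N e i).
Proof. by move=> e; apply/ffunP => j; rewrite !ffunE; case: eqP; rewrite ?negbK. Qed.

Lemma flip_same N (e : {ffun 'I_N -> bool}) i : flip N e i i = ~~ e i.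
Proof. by rewrite ffunE eqxx. Qed.

Lemma flip_other N (e : {ffun 'I_N -> bool}) i j : j != i -> flip N e i j = e j.
Proof. by move=> ji; rewrite ffunE (negPf ji). Qed.

Lemma sum_flip N (P : pred 'I_N) (c : 'I_N -> R) (e : {ffun 'I_N -> bool}) i : P i ->
  \sum_(j | P j) (-1) ^+ e j * c j - \sum_(j | P j) (-1) ^+ flip N e i j * c j =
  2 * (-1) ^+ e i * c i.
Proof.
move=> Pi; rewrite (bigD1 i)//= [in X in _ - X](bigD1 i)//= flip_same.
rewrite [X in _ - (_ + X)](eq_bigr (fun j => (-1) ^+ e j * c j)) => [|j /andP[_ ji]]; last first.
  by rewrite flip_other.
by case: (e i); rewrite /= ?expr1 ?expr0; ring.
Qed.

(** * Second moment of an error under flips of unread signs *)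

Section Flipping.
Variables (N : nat) (c : 'I_N -> R) (Q : {ffun 'I_N -> bool} -> {set 'I_N}).
Hypothesis Q_flip : forall e i, i \notin Q e -> Q (flip N e i) = Q e.

(** With [Q e] the signs read, [T] stands for the error at [b]: flipping an unread sign leaves the
    output alone and moves only the solution. *)
Let flip_responsive (T : {ffun 'I_N -> bool} -> R) :=
  forall e i, i \notin Q e -> T e - T (flip N e i) = 2 * (-1) ^+ e i * c i.

Let Z (e : {ffun 'I_N -> bool}) : R := \sum_(i | i \notin Q e) (-1) ^+ e i * c i.

Let notinQ_flip e i : (i \notin Q (flip N e i)) = (i \notin Q e).
Proof.
apply/idP/idP => iQ; last by rewrite Q_flip.
by have := Q_flip _ _ iQ; rewrite [flip N _ i](flipK _ i e) => ->.
Qed.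

(* The sum for a fixed i is symmetrized by the involution flipping i. *)
Lemma flip_pairing T : flip_responsive T ->
  \sum_e T e * Z e = \sum_e \sum_(i | i \notin Q e) c i ^+ 2.
Proof.
move=> TP; under eq_bigr do rewrite mulr_sumr.
rewrite (exchange_big_dep predT)//= [RHS](exchange_big_dep predT)//=.
apply: eq_bigr => i _; set A := LHS.
have AE : A = \sum_(e | i \notin Q e) - T (flip N e i) * ((-1) ^+ e i * c i).
  rewrite /A (reindex_inj (can_inj (flipK N i))) /=.
  apply: eq_big => e; first exact: notinQ_flip.
  by rewrite flip_same => _; case: (e i); rewrite /= ?expr1 ?expr0; ring.
suff : A + A = \sum_(e | i \notin Q e) 2 * c i ^+ 2.
  by rewrite -mulr_sumr => AA; lra.
rewrite {2}AE -big_split /=; apply: eq_bigr => e iQ.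
by rewrite -mulrDl TP//; case: (e i); rewrite /= ?expr1 ?expr0; ring.
Qed.

Lemma flip_responsive_Z : flip_responsive Z.
Proof.
move=> e i iQ; rewrite /Z Q_flip//; exact: (sum_flip _ (fun i => i \notin Q e)).
Qed.

(** [Z] is the contribution of the unread signs. By [flip_pairing] the sums of [T * Z] and [Z * Z]
    agree, so [(T - Z) ^+ 2 >= 0] bounds the sum of [T ^+ 2] below by that of [Z ^+ 2]. *)
Lemma sum_sqr_ge T c0 n : flip_responsive T -> 0 <= c0 -> (forall i, c0 <= c i) ->
  (forall e, #|Q e| <= n)%N -> 2 ^+ N * ((N%:R - n%:R) * c0 ^+ 2) <= \sum_e T e ^+ 2.
Proof.
move=> TP c00 c0c Qn; apply: le_trans (_ : \sum_e \sum_(i | i \notin Q e) c i ^+ 2 <= _).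
  have -> : 2 ^+ N = #|{ffun 'I_N -> bool}|%:R :> R.
    by rewrite card_ffun card_bool card_ord natrX.
  rewrite mulr_natl -sumr_const; apply: ler_sum => e _.
  apply: le_trans (_ : \sum_(i | i \notin Q e) c0 ^+ 2 <= _); last first.
    by apply: ler_sum => i _; rewrite lerXn2r ?nnegrE// (le_trans c00).
  rewrite sumr_const -[c0 ^+ 2 *+ _]mulr_natl ler_wpM2r ?exprn_ge0//.
  rewrite lerBlDr -natrD ler_nat.
  have -> : #|[pred i | i \notin Q e]| = #|~: Q e|.
    by apply: eq_card => i; rewrite !inE.
  by rewrite -[X in (X <= _)%N]card_ord -(cardsC (Q e)) addnC leq_add2l.
have <- : \sum_e (2 * (T e * Z e) - Z e * Z e) = \sum_e \sum_(i | i \notin Q e) c i ^+ 2.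
  rewrite sumrB -mulr_sumr (flip_pairing _ TP) (flip_pairing _ flip_responsive_Z); ring.
by apply: ler_sum => e _; have := sqr_ge0 (T e - Z e); rewrite sqrrB; lra.
Qed.

End Flipping.

Section Deterministic.
Variables (r q N n : nat) (a b : R) (G : {ffun 'I_N -> bool} -> 'rV[R]_q.+2 -> R).
Variables (idx : 'rV[R]_q.+2 -> 'I_N) (A : det_alg R q).
Hypothesis G_local : forall (e e' : {ffun 'I_N -> bool}) s z, (size s <= r)%N ->
  e (idx z) = e' (idx z) -> pderivs s (G e) z = pderivs s (G e') z.
Hypothesis A_adm : det_admissible a b r A.

Let Q (e : {ffun 'I_N -> bool}) : {set 'I_N} :=
  [set idx (dnode A (info A (G e) j)).2 | j : 'I_n].

(** Adaptivity is harmless: as long as sign [i] is unread, the answers agree, hence so do the next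
    nodes. *)
Lemma info_flip e i j : (j <= n)%N -> i \notin Q e ->
  info A (G (flip N e i)) j = info A (G e) j.
Proof.
elim: j => [//|j IHj] jn iQ; rewrite /= IHj ?(ltnW jn)//; congr rcons.
apply: G_local; first exact: (A_adm _).1.
rewrite flip_other//; apply: contraNneq iQ => <-.
by apply/imsetP; exists (Ordinal jn).
Qed.

Lemma det_sqr_error_ge (c : 'I_N -> R) (c0 v : R) (u : {ffun 'I_N -> bool} -> R) :
  0 <= c0 -> (forall i, c0 <= c i) -> (forall e, u e = v + \sum_i (-1) ^+ e i * c i) ->
  2 ^+ N * ((N%:R - n%:R) * c0 ^+ 2) <=
    \sum_e (u e - det_output A (G e) n b) ^+ 2.
Proof.
move=> c00 c0c uE; apply: (@sum_sqr_ge N c Q) => // [e i iQ|e i iQ|e].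
- by apply: eq_imset => j; rewrite info_flip// ltnW.
- rewrite /det_output info_flip// opprB addrA subrK !uE opprD addrACA subrr add0r.
  exact: sum_flip.
- by apply: leq_trans (leq_imset_card _ _) _; rewrite card_ord.
Qed.

End Deterministic.

Lemma sup_err_ge (a b x : R) (u l : R -> R) : a <= x <= b ->
  ((`|u x - l x|)%:E <= sup_err a b u l)%E.
Proof. by move=> ax; apply: ereal_sup_ubound; exists x. Qed.

Lemma rand_error_lower r k q N n (a b : R) (D ua : nat -> R) (d : measure_display)
    (Omega : measurableType d) (P : probability Omega R) (A : Omega -> det_alg R q)
    (G : {ffun 'I_N -> bool} -> 'rV[R]_q.+2 -> R) (u : {ffun 'I_N -> bool} -> R -> R)
    (idx : 'rV[R]_q.+2 -> 'I_N) (c : 'I_N -> R) (c0 v eps : R) :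
  a <= b -> (n <= N)%N -> (forall e, classG a b r D (G e)) ->
  (forall e, is_solution a b k ua (G e) (u e)) ->
  (forall e, u e b = v + \sum_i (-1) ^+ e i * c i) ->
  0 <= c0 -> (forall i, c0 <= c i) ->
  (forall (e e' : {ffun 'I_N -> bool}) s z, (size s <= r)%N ->
    e (idx z) = e' (idx z) -> pderivs s (G e) z = pderivs s (G e') z) ->
  (forall w, det_admissible a b r (A w)) ->
  rand_error_le P a b k r D ua n A eps ->
  (N%:R - n%:R) * c0 ^+ 2 <= eps ^+ 2.
Proof.
move=> ab nN GD Gu uE c00 c0c Gloc Aadm err.
pose E e w := sup_err a b (u e) (det_output (A w) (G e) n).
have Eb e w : ((`|u e b - det_output (A w) (G e) n b|)%:E <= E e w)%E.
  by apply: sup_err_ge; rewrite ab lexx.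
have E0 e w : (0 <= E e w)%E by apply: le_trans (Eb e w); rewrite lee_fin.
have mEE e : measurable_fun [set: Omega]%classic (fun w => E e w * E e w)%E.
  by have [mE _] := err _ _ (GD e) (Gu e); exact: emeasurable_funM.
have p2 : 0 < 2 ^+ N :> R by apply: exprn_gt0; rewrite ltr0n.
rewrite -(ler_pM2l p2) -lee_fin.
(* Only a constant and a sum of squared sup errors are integrated, both measurable; the errors at
   [b] enter between them, for each fixed [w]. *)
apply: (@le_trans _ _ (\int[P]_(w in setT) (2 ^+ N * ((N%:R - n%:R) * c0 ^+ 2))%:E)%E).
  rewrite integral_cst//; set PT := (X in (_ * X)%E).
  by rewrite (_ : PT = 1%E) ?mule1//; exact: probability_setT.
apply: (@le_trans _ _ (\int[P]_(w in setT) (\sum_(e : {ffun 'I_N -> bool}) (E e w * E e w)))%E).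
  have det_ge w := det_sqr_error_ge _ _ _ _ _ _ _ _ (A w) Gloc (Aadm w) c c0 v (fun e => u e b) c00 c0c uE.
  apply: ge0_le_integral => //.
  - move=> w _; rewrite lee_fin !mulr_ge0 ?exprn_ge0// subr_ge0 ler_nat//.
  - exact: emeasurable_sum.
  move=> w _; apply: le_trans (_ : ((\sum_e (u e b - det_output (A w) (G e) n b) ^+ 2)%:E <= _)%E).
    by rewrite lee_fin.
  rewrite -sumEFin; apply: lee_sum => e _.
  rewrite -real_normK ?num_real// expr2 EFinM; apply: lee_pmul => //; by rewrite lee_fin.
rewrite ge0_integral_sum//; last by move=> e w _; exact: mule_ge0.
apply: le_trans (_ : (\sum_(e : {ffun 'I_N -> bool}) (eps ^+ 2)%:E <= _)%E).
  by apply: lee_sum => e _; have [_] := err _ _ (GD e) (Gu e).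
rewrite sumEFin lee_fin sumr_const card_ffun card_bool card_ord.
by rewrite -[eps ^+ 2 *+ _]mulr_natl natrX.
Qed.

End Randomized.

(** * Quantum algorithms *)

Section Quantum.
Import complex.
Context {R : realType}.
Implicit Types (M : nat).

(** The real part of the Hermitian product; it suffices for the adversary argument and keeps all
    sums in [R]. *)
Definition cdot (x y : R[i]) : R := Re x * Re y + Im x * Im y.

Definition ip M (v w : 'cV[R[i]]_M) : R := \sum_l cdot (v l ord0) (w l ord0).

Lemma cdotE x y : cdot x y = Re (cconj x * y).
Proof. by case: x => [xr xi]; case: y => [yr yi]; rewrite /cdot /= mulNr opprK. Qed.

Lemma cdotxx x : cdot x x = sqmod x.
Proof. by rewrite /cdot -!expr2. Qed.

Lemma sqmod_ge0 (x : R[i]) : 0 <= sqmod x.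
Proof. by rewrite addr_ge0 ?sqr_ge0. Qed.

Lemma cdot_le x y : cdot x y <= (sqmod x + sqmod y) / 2.
Proof.
rewrite /cdot /sqmod; have := sqr_ge0 (Re x - Re y); have := sqr_ge0 (Im x - Im y).
by rewrite !sqrrB; lra.
Qed.

Lemma cdot_ge x y : - ((sqmod x + sqmod y) / 2) <= cdot x y.
Proof.
rewrite /cdot /sqmod; have := sqr_ge0 (Re x + Re y); have := sqr_ge0 (Im x + Im y).
by rewrite !sqrrD; lra.
Qed.

(* AM-GM with weights 1/2 and 2, which makes the bound of [ip_distinguish] smaller than 1. *)
Lemma cdot_le_weighted x y : cdot x y <= sqmod x / 4 + sqmod y.
Proof.
rewrite /cdot /sqmod; have := sqr_ge0 (Re x / 2 - Re y); have := sqr_ge0 (Im x / 2 - Im y).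
by rewrite !sqrrB !expr_div_n; lra.
Qed.

Lemma cdotC x y : cdot x y = cdot y x.
Proof. by rewrite /cdot [Re x * _]mulrC [Im x * _]mulrC. Qed.

Lemma ipE M (v w : 'cV[R[i]]_M) :
  ip M v w = Re (((map_mx (@cconj R) v)^T *m w) ord0 ord0).
Proof.
rewrite mxE (@big_morph _ _ (@Re R) 0 +%R) => [|x y|//]; last by case: x y => [? ?] [].
by apply: eq_bigr => l _; rewrite cdotE !mxE.
Qed.

Lemma ip_unitary M (U : 'M[R[i]]_M) v w : unitary U -> ip M (U *m v) (U *m w) = ip M v w.
Proof.
have cE : @cconj R = conjc by apply/funext => -[].
rewrite /unitary !ipE cE => Uu.
have -> : map_mx conjc (U *m v) = map_mx conjc U *m map_mx conjc v by exact: map_mxM.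
by rewrite trmx_mul -mulmxA (mulmxA _ U) Uu mul1mx.
Qed.

Lemma ipxx M (v : 'cV[R[i]]_M) : ip M v v = \sum_l sqmod (v l ord0).
Proof. by apply: eq_bigr => l _; rewrite cdotxx. Qed.

(** [Bv] and [Bw] are the outcomes that are wrong for [v] and [w]. Off [Bv] the vector [w] has small
    mass. With [p] and [s] the two small masses, the weighted bound gives [1/2 + 3/4 (p + s)]. *)
Lemma ip_distinguish M (v w : 'cV[R[i]]_M) (Bv Bw : pred 'I_M) :
  ip M v v = 1 -> ip M w w = 1 ->
  (forall l, Bv l || Bw l) ->
  \sum_(l | Bv l) sqmod (v l ord0) <= 4^-1 ->
  \sum_(l | Bw l) sqmod (w l ord0) <= 4^-1 ->
  ip M v w <= 7 / 8.
Proof.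
rewrite !ipxx /ip => v1 w1 BB Pv Pw.
rewrite (bigID Bv) /= in v1; rewrite (bigID Bv) /= in w1; rewrite (bigID Bv) /=.
have Pw' : \sum_(l | ~~ Bv l) sqmod (w l ord0) <= 4^-1.
  apply: le_trans Pw; rewrite [leRHS](bigID Bv) /= addrC.
  rewrite (eq_bigl (fun l => Bw l && ~~ Bv l)) => [|l].
    by rewrite lerDl sumr_ge0// => l _; exact: sqmod_ge0.
  by have := BB l; case: (Bv l); case: (Bw l).
have S1 : \sum_(l | Bv l) cdot (v l ord0) (w l ord0) <=
    (\sum_(l | Bv l) sqmod (w l ord0)) / 4 + \sum_(l | Bv l) sqmod (v l ord0).
  by rewrite mulr_suml -big_split; apply: ler_sum => l _; rewrite cdotC cdot_le_weighted.
have S2 : \sum_(l | ~~ Bv l) cdot (v l ord0) (w l ord0) <=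
    (\sum_(l | ~~ Bv l) sqmod (v l ord0)) / 4 + \sum_(l | ~~ Bv l) sqmod (w l ord0).
  by rewrite mulr_suml -big_split; apply: ler_sum => l _; rewrite cdot_le_weighted.
lra.
Qed.

Lemma lt_digits i y M K : (i < M -> y < K -> i + M * y < M * K)%N.
Proof. by move=> iM yK; apply: leq_trans (leq_mul (leqnn M) yK); rewrite mulnS -addSn leq_add2r. Qed.

(** * Query operators as permutations of basis states *)

Section Query.
Variables (a b : R) (q : nat) (Q : quantum_query R q).
Hypothesis Q_ok : query_ok a b Q.

Let M1 := (2 ^ qm1 Q)%N.
Let M2 := (2 ^ qm2 Q)%N.

Lemma query_perm_mod g l : (query_perm Q g l %% M1)%N = (l %% M1)%N.
Proof. by rewrite /query_perm -/M1 addnC mulnC modnMDl modn_mod. Qed.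

Lemma query_perm_lt g l : (l < 2 ^ qm Q)%N -> (query_perm Q g l < 2 ^ qm Q)%N.
Proof.
have [le_m _] := Q_ok; move=> lm.
have M10 : (0 < M1)%N by rewrite expn_gt0.
have M20 : (0 < M2)%N by rewrite expn_gt0.
(* The size of the register [y], the leading digit in the mixed radix [M1], [M2], [K]. *)
pose K := (2 ^ (qm Q - (qm1 Q + qm2 Q)))%N.
have ME : (2 ^ qm Q = M1 * (M2 * K))%N by rewrite mulnA -!expnD subnKC.
rewrite ME in lm *; rewrite /query_perm -/M1 -/M2.
set i := (l %% M1)%N; set y := (l %/ (M1 * M2))%N.
have yK : (y < K)%N by rewrite ltn_divLR ?muln_gt0 ?M10// mulnC -mulnA.
have iM : (i < M1)%N by rewrite ltn_mod.
set x := (if _ then _ else _).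
have xM : (x < M2)%N by rewrite /x; case: ifP => _; rewrite ltn_mod.
by apply: lt_digits => //; exact: lt_digits.
Qed.

(** The digits are recovered in turn: [i] is unchanged, it determines the shift of [x] modulo [M2],
    and [y] is what remains. *)
Lemma query_perm_inj g : injective (query_perm Q g).
Proof.
move=> l l' E; have M10 : (0 < M1)%N by rewrite expn_gt0.
have M20 : (0 < M2)%N by rewrite expn_gt0.
have Ei : (l %% M1 = l' %% M1)%N by rewrite -(query_perm_mod g) E query_perm_mod.
move: E; rewrite /query_perm -/M1 -/M2 Ei => /addnI/eqP; rewrite eqn_pmul2l// => /eqP E.
set x := (if _ then _ else _) in E; set x' := (if _ then _ else _) in E.
have xM : (x < M2)%N by rewrite /x; case: ifP => _; rewrite ltn_mod.
have xM' : (x' < M2)%N by rewrite /x'; case: ifP => _; rewrite ltn_mod.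
have Ex : x = x'.
  by move: (congr1 (modn^~ M2) E); rewrite ![(_ + M2 * _)%N]addnC ![(M2 * _)%N]mulnC !modnMDl !modn_small.
move: E; rewrite Ex => /addnI/eqP; rewrite eqn_pmul2l// => /eqP Ey.
have {}Ex : ((l %/ M1) %% M2 = (l' %/ M1) %% M2)%N.
  move: Ex; rewrite /x /x'; case: ifP => // _ /eqP.
  by rewrite eqn_modDr !modn_mod => /eqP.
rewrite (divn_eq l M1) (divn_eq l' M1) Ei (divn_eq (l %/ M1) M2) (divn_eq (l' %/ M1) M2) Ex.
by rewrite -!divnMA Ey.
Qed.

Definition query_fun g (l : 'I_(2 ^ qm Q)) : 'I_(2 ^ qm Q) :=
  Ordinal (query_perm_lt g l (ltn_ord l)).

Lemma query_fun_inj g : injective (query_fun g).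
Proof. by move=> l l' /(congr1 val) /= /query_perm_inj ll; apply: val_inj. Qed.

Lemma query_mxE g v l : (query_mx Q g *m v) (query_fun g l) ord0 = v l (ord0 : 'I_1).
Proof.
rewrite mxE (bigD1 l)//= mxE eqxx mul1r big1 ?addr0// => l' l'l.
rewrite mxE -[val _]/(val (query_fun g l)) ifN ?mul0r//.
by apply: contraNneq l'l => /query_perm_inj E; apply/eqP/val_inj.
Qed.

Variables (N : nat) (G : {ffun 'I_N -> bool} -> 'rV[R]_q.+2 -> R) (idx : 'rV[R]_q.+2 -> 'I_N).
Hypothesis G_local : forall (e e' : {ffun 'I_N -> bool}) z,
  e (idx z) = e' (idx z) -> G e z = G e' z.

(** The basis states at which the query sees sign [i]; outside [qZ] the query acts as the
    identity. *)
Definition touches i (l : nat) := qZ Q (l %% M1)%N && (idx (qtau Q (l %% M1)%N) == i).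

Definition mass i (v : 'cV[R[i]]_(2 ^ qm Q)) : R := \sum_(l | touches i (val l)) sqmod (v l ord0).

Lemma touches_query_fun i g l : touches i (val (query_fun g l)) = touches i (val l).
Proof. by rewrite /touches /= query_perm_mod. Qed.

Lemma query_fun_flip e i l : ~~ touches i (val l) -> query_fun (G (flip N e i)) l = query_fun (G e) l.
Proof.
move=> nt; apply: val_inj; rewrite /= /query_perm; case: ifP => // Zl.
rewrite (G_local _ e)// flip_other//; apply: contraNneq nt => idxi.
by rewrite /touches Zl idxi eqxx.
Qed.

Lemma mass_query i g v : mass i (query_mx Q g *m v) = mass i v.
Proof.
rewrite /mass (reindex_inj (query_fun_inj g)); apply: eq_big => l.
  by rewrite touches_query_fun.
by rewrite query_mxE.
Qed.

Lemma ip_query_same g v w : ip _ (query_mx Q g *m v) (query_mx Q g *m w) = ip _ v w.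
Proof. by rewrite /ip (reindex_inj (query_fun_inj g)); apply: eq_bigr => l _; rewrite !query_mxE. Qed.

Lemma sum_mass_le v : \sum_i mass i v <= ip _ v v.
Proof.
rewrite ipxx /mass (exchange_big_dep predT)//=; apply: ler_sum => l _.
case: (boolP (qZ Q (val l %% M1)%N)) => Zl; last first.
  by rewrite big_pred0 ?sqmod_ge0// => i; rewrite /touches (negPf Zl).
by rewrite (big_pred1 (idx (qtau Q (val l %% M1)%N))) // => i; rewrite /touches Zl /= eq_sym.
Qed.

(** The two queries agree on untouched states. On touched ones the inner product is at most half the
    total mass in absolute value, before and after, since a query preserves [mass]. *)
Lemma ip_query_ge e i v w :
  ip _ v w - (mass i v + mass i w) <=
  ip _ (query_mx Q (G e) *m v) (query_mx Q (G (flip N e i)) *m w).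
Proof.
set v' := _ *m v; set w' := _ *m w; pose t l := touches i (val (l : 'I_(2 ^ qm Q))).
rewrite /ip (bigID t) [leRHS](bigID t) /=.
have Eout : \sum_(l | ~~ t l) cdot (v' l ord0) (w' l ord0) = \sum_(l | ~~ t l) cdot (v l ord0) (w l ord0).
  rewrite (reindex_inj (query_fun_inj (G e))); apply: eq_big => l.
    by rewrite /t touches_query_fun.
  rewrite /t touches_query_fun => nt.
  by rewrite /v' query_mxE -{1}(query_fun_flip _ _ _ nt) /w' query_mxE.
have Ein : - ((mass i v' + mass i w') / 2) <= \sum_(l | t l) cdot (v' l ord0) (w' l ord0).
  rewrite /mass -big_split /= mulr_suml -sumrN; apply: ler_sum => l _; exact: cdot_ge.
have Ein0 : \sum_(l | t l) cdot (v l ord0) (w l ord0) <= (mass i v + mass i w) / 2.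
  rewrite /mass -big_split /= mulr_suml; apply: ler_sum => l _; exact: cdot_le.
rewrite !mass_query in Ein.
by rewrite Eout; lra.
Qed.

End Query.

(** * Adversary argument on the hypercube of signs *)

Section Adversary.
Variables (a b : R) (q N n : nat) (A : quantum_alg R q).
Variables (G : {ffun 'I_N -> bool} -> 'rV[R]_q.+2 -> R) (idx : 'rV[R]_q.+2 -> 'I_N).
Hypothesis A_ok : qalg_ok a b n A.
Hypothesis G_local : forall (e e' : {ffun 'I_N -> bool}) z,
  e (idx z) = e' (idx z) -> G e z = G e' z.

Definition state g j : 'cV[R[i]]_(2 ^ qm (qquery A)) :=
  qop A g j *m \col_l (if val l == 0%N then 1 else 0).

Lemma stateS g j : state g j.+1 = qU A j.+1 *m (query_mx (qquery A) g *m state g j).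
Proof. by rewrite /state /= !mulmxA. Qed.

Lemma qprobE g l : qprob g n l = sqmod (state g n l ord0).
Proof.
rewrite /qprob /state mxE big_mkcond /=; congr sqmod; apply: eq_bigr => l0 _.
by rewrite mxE; case: ifP; rewrite ?mulr1 ?mulr0.
Qed.

Lemma ip_state0 g g' : ip _ (state g 0) (state g' 0) = 1.
Proof.
rewrite /state /= ip_unitary; last exact: A_ok.2.
have p2 : (0 < 2 ^ qm (qquery A))%N by rewrite expn_gt0.
rewrite ipxx (bigD1 (Ordinal p2))//= big1 => [|l l0]; last first.
  by rewrite mxE ifN ?/sqmod //= ?expr0n ?addr0.
by rewrite mxE /= /sqmod /= expr1n expr0n !addr0.
Qed.

Lemma ip_state g j : (j <= n)%N -> ip _ (state g j) (state g j) = 1.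
Proof.
elim: j => [|j IHj] jn; first exact: ip_state0.
rewrite stateS ip_unitary; last exact: A_ok.2.
rewrite (ip_query_same a b q _ A_ok.1).
exact: IHj (ltnW jn).
Qed.

(** Every edge of the hypercube is counted in both directions. *)
Let progress j := \sum_e \sum_i ip _ (state (G e) j) (state (G (flip N e i)) j).

Lemma progress0 : progress 0 = 2 ^+ N * N%:R.
Proof.
rewrite /progress (eq_bigr (fun=> N%:R)) => [|e _]; last first.
  by under eq_bigr do rewrite ip_state0; rewrite sumr_const card_ord.
by rewrite sumr_const card_ffun card_bool card_ord -[_ *+ (2 ^ N)]mulr_natl natrX.
Qed.

Lemma progressS j : (j < n)%N -> progress j - 2 * 2 ^+ N <= progress j.+1.
Proof.
move=> jn; pose m i e := mass q (qquery A) N idx i (state (G e) j).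
have sm e : \sum_i m i e <= 1.
  by apply: le_trans (sum_mass_le _ _ _ _ _) _; rewrite ip_state// ltnW.
have m1 : \sum_e \sum_i m i e <= 2 ^+ N.
  apply: le_trans (ler_sum _ (fun e _ => sm e)) _.
  by rewrite sumr_const card_ffun card_bool card_ord natrX.
(* For each [i], flipping permutes the vertices, so the far ends carry the same total mass. *)
have m2 : \sum_e \sum_i m i (flip N e i) <= 2 ^+ N.
  rewrite exchange_big /=; apply: le_trans m1; rewrite [leRHS]exchange_big /=.
  by apply: ler_sum => i _; rewrite [leRHS](reindex_inj (can_inj (flipK N i))).
apply: le_trans (_ : \sum_e \sum_i (ip _ (state (G e) j) (state (G (flip N e i)) j)
    - (m i e + m i (flip N e i))) <= _); last first.
  apply: ler_sum => e _; apply: ler_sum => i _.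
  rewrite !stateS ip_unitary; last exact: A_ok.2.
  exact: (ip_query_ge a b q _ A_ok.1).
have -> : \sum_e \sum_i (ip _ (state (G e) j) (state (G (flip N e i)) j)
    - (m i e + m i (flip N e i))) =
    progress j - (\sum_e \sum_i m i e + \sum_e \sum_i m i (flip N e i)).
  rewrite /progress -big_split -sumrB; apply: eq_bigr => e _ /=.
  by rewrite -big_split -sumrB.
by lra.
Qed.

Lemma adversary_bound :
  (forall e i, ip _ (state (G e) n) (state (G (flip N e i)) n) <= 7 / 8) ->
  (N <= 16 * n)%N.
Proof.
move=> ip78.
have prog_ge j : (j <= n)%N -> 2 ^+ N * (N%:R - 2 * j%:R) <= progress j.
  elim: j => [_|j IHj jn]; first by rewrite progress0 mulr0 subr0.
  apply: le_trans (progressS _ jn); have := IHj (ltnW jn).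
  by rewrite -natr1; nra.
have prog_le : progress n <= 2 ^+ N * (N%:R * (7 / 8)).
  apply: le_trans (ler_sum _ (fun e _ => ler_sum _ (fun i _ => ip78 e i))) _.
  rewrite !sumr_const card_ffun card_bool !card_ord.
  by rewrite -[_ *+ (2 ^ N)]mulr_natl natrX -[(7 / 8) *+ _]mulr_natl.
have p2 : 0 < 2 ^+ N :> R by apply: exprn_gt0; rewrite ltr0n.
have := le_trans (prog_ge _ (leqnn n)) prog_le; rewrite (ler_pM2l p2) => h.
by rewrite -(ler_nat R) natrM; lra.
Qed.

End Adversary.

Lemma quant_error_lower r k q N n (a b : R) (D ua : nat -> R) (A : quantum_alg R q)
    (G : {ffun 'I_N -> bool} -> 'rV[R]_q.+2 -> R) (u : {ffun 'I_N -> bool} -> R -> R)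
    (idx : 'rV[R]_q.+2 -> 'I_N) (c : 'I_N -> R) (c0 v eps : R) :
  a <= b -> (forall e, classG a b r D (G e)) ->
  (forall e, is_solution a b k ua (G e) (u e)) ->
  (forall e, u e b = v + \sum_i (-1) ^+ e i * c i) ->
  0 < eps -> 2 * eps < c0 -> (forall i, c0 <= c i) ->
  (forall (e e' : {ffun 'I_N -> bool}) z, e (idx z) = e' (idx z) -> G e z = G e' z) ->
  qalg_ok a b n A -> quant_error_le a b k r D ua n A eps ->
  (N <= 16 * n)%N.
Proof.
move=> ab GD Gu uE eps0 eps_c0 c0c Gloc Aok err.
(* [qerr] is an infimum, perhaps not attained; the margin from [eps] to [2 * eps] yields a level
   [al] that satisfies the probability bound. *)
pose far e := fun l : 'I_(2 ^ qm (qquery A)) => (sup_err a b (u e) (qphi A (val l)) > (2 * eps)%:E)%E.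
have far_le e : \sum_(l | far e l) sqmod (state q A (G e) n l ord0) <= 4^-1.
  have /ereal_inf_lt[_ [al al4 <-]] : (qerr a b A (G e) n (u e) < (2 * eps)%:E)%E.
    by apply: le_lt_trans (err _ _ (GD e) (Gu e)) _; rewrite lte_fin; lra.
  rewrite lte_fin => al_eps; apply: le_trans al4; rewrite /qprob_err_gt.
  under [leRHS]eq_bigr do rewrite qprobE.
  rewrite big_mkcond [leRHS]big_mkcond; apply: ler_sum => l _; rewrite /far.
  case: ifP => [f2|_]; last by case: ifP => _ //; exact: sqmod_ge0.
  by rewrite (lt_trans _ f2)// lte_fin.
apply: (adversary_bound a b q N n A G idx Aok Gloc) => e i.
apply: (ip_distinguish _ _ _ (far e) (far (flip N e i))) => //.
- exact: (ip_state _ _ _ _ _ Aok).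
- exact: (ip_state _ _ _ _ _ Aok).
(* An outcome good for both sign vectors would place the two values at [b] within [4 * eps], below
   their distance [2 * c i]. *)
move=> l; rewrite /far !ltNge -negb_and; apply/negP => /andP[le1 le2].
have ge_b (f : {ffun 'I_N -> bool}) : (sup_err a b (u f) (qphi A (val l)) <= (2 * eps)%:E)%E ->
    `|u f b - qphi A (val l) b| <= 2 * eps.
  move=> le; rewrite -lee_fin; apply: le_trans le.
  by apply: sup_err_ge; rewrite ab lexx.
have /andP[b1 b2] : - (2 * eps) <= u e b - qphi A (val l) b <= 2 * eps by rewrite -ler_norml ge_b.
have /andP[b3 b4] : - (2 * eps) <= u (flip N e i) b - qphi A (val l) b <= 2 * eps by rewrite -ler_norml ge_b.
have ci := c0c i.
have : u e b - u (flip N e i) b = 2 * (-1) ^+ e i * c i.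
  by rewrite !uE opprD addrACA subrr add0r sum_flip.
by case: (e i); rewrite /= ?expr1 ?expr0; lra.
Qed.

End Quantum.

(** * Complexity *)

Lemma le_root_powR (R : realType) (x K m : R) (s p : nat) :
  0 <= x -> 0 <= K -> 0 <= m -> (0 < p)%N -> x ^+ s <= K * m ^+ p ->
  x `^ (s%:R / p%:R) <= K `^ p%:R^-1 * m.
Proof.
move=> x0 K0 m0 p0 le_sp; have p_neq0 : p%:R != 0 :> R by rewrite pnatr_eq0 -lt0n.
rewrite powRrM powR_mulrn//.
have -> : K `^ p%:R^-1 * m = (K * m ^+ p) `^ p%:R^-1.
  by rewrite powRM ?exprn_ge0// -(powR_mulrn p m0) -powRrM mulfV// powRr1.
by apply: ge0_ler_powR; rewrite ?invr_ge0 ?nnegrE ?mulr_ge0 ?exprn_ge0.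
Qed.

(** For small [eps] the hypothesis fails at [n = 0]; otherwise [16 * n.+1 <= 32 * n], and a [p]-th
    root gives the claim. *)
Lemma complexity_of_error_bound (R : realType) (K : R) (s p : nat) :
  0 < K -> (0 < s)%N -> (0 < p)%N -> exists C eps0 : R, [/\ 0 < C, 0 < eps0 &
    forall n eps, 0 < eps < eps0 -> eps^-1 ^+ s <= K * (16 * n.+1)%:R ^+ p ->
      C * eps^-1 `^ (s%:R / p%:R) <= n%:R].
Proof.
move=> K0 s0 p0; pose L := K `^ p%:R^-1; have L0 : 0 < L by exact: powR_gt0.
have KX : 0 < K * 16 ^+ p by rewrite mulr_gt0// exprn_gt0.
exists (32 * L)^-1, (1 + K * 16 ^+ p)^-1; split.
- by rewrite invr_gt0 mulr_gt0.
- by rewrite invr_gt0 addr_gt0.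
move=> n eps /andP[e0 e_lt] le_sp.
have einv : 1 + K * 16 ^+ p < eps^-1.
  by rewrite -[ltLHS]invrK ltf_pV2// posrE// invr_gt0 addr_gt0.
have n0 : (0 < n)%N.
  rewrite lt0n; apply: contraTneq le_sp => ->; rewrite -ltNge muln1.
  apply: lt_le_trans (_ : eps^-1 <= _); first by lra.
  by apply: ler_eXnr => //; lra.
rewrite mulrC ler_pdivrMr ?mulr_gt0//.
have einv0 : 0 <= eps^-1 by rewrite invr_ge0 ltW.
apply: le_trans (le_root_powR _ _ _ _ _ _ einv0 (ltW K0) _ p0 le_sp) _ => //.
rewrite -/L (_ : n%:R * (32 * L) = L * (32 * n%:R)); last by ring.
by rewrite (ler_pM2l L0) -natrM ler_nat; lia.
Qed.

Theorem theorem1 (R : realType) (r k q : nat) (a b : R) (D : nat -> R) :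
  (1 <= r)%N -> (1 <= k)%N -> (q < k)%N -> a < b ->
  (forall j, (j <= r)%N -> 0 < D j) ->
  exists (C eps0 : R), 0 < C /\ 0 < eps0 /\
  forall (ua : nat -> R) (eps : R), 0 < eps < eps0 ->
    (* randomized setting *)
    (forall (d : measure_display) (Omega : measurableType d)
            (P : probability Omega R) (n : nat) (A : Omega -> det_alg R q),
        (forall w, det_admissible a b r (A w)) ->
        rand_error_le P a b k r D ua n A eps ->
        C * (eps^-1) `^ ((r%:R + 2^-1)^-1) <= n%:R) /\
    (* quantum setting *)
    (forall (n : nat) (A : quantum_alg R q),
        qalg_ok a b n A ->
        quant_error_le a b k r D ua n A eps ->
        C * (eps^-1) `^ ((r%:R + 1)^-1) <= n%:R).
Proof.
move=> _ k0 _ ab D0; have [c0 c00 fam] := hard_family r k q a b D k0 ab D0.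
(* The premise is [(N - n) * (c0 / N ^ (r + 1)) ^ 2 <= eps ^ 2] solved for [eps^-1], using
   [N - n >= N / 2]. *)
have [Cr [er [Cr0 er0 randP]]] : exists C eps0 : R, [/\ 0 < C, 0 < eps0 &
    forall n eps, 0 < eps < eps0 -> eps^-1 ^+ 2 <= 2 / c0 ^+ 2 * (16 * n.+1)%:R ^+ (2 * r).+1 ->
      C * eps^-1 `^ (2 / (2 * r).+1%:R) <= n%:R].
  by apply: complexity_of_error_bound; rewrite ?divr_gt0 ?exprn_gt0.
have [Cq [eq [Cq0 eq0 quantP]]] : exists C eps0 : R, [/\ 0 < C, 0 < eps0 &
    forall n eps, 0 < eps < eps0 -> eps^-1 ^+ 1 <= 2 / c0 * (16 * n.+1)%:R ^+ r.+1 ->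
      C * eps^-1 `^ (1 / r.+1%:R) <= n%:R].
  by apply: complexity_of_error_bound; rewrite ?divr_gt0.
exists (Num.min Cr Cq), (Num.min er eq); rewrite !lt_min Cr0 Cq0 er0 eq0; do 2![split=> //].
move=> ua eps; rewrite lt_min => /and3P[e0 e_r e_q].
split=> [d Omega P n A Aadm err|n A Aok err].
(* The family is indexed by [N.+1] signs, and [(16 * n + 15).+1 = 16 * n.+1]. *)
- have [G [c [idx [GD Gu cP Gloc]]]] := fam (16 * n + 15)%N.
  have [u [v uP]] := Gu ua.
  have := rand_error_lower r k q _ n a b D ua d Omega P A G u idx c _ v eps (ltW ab) _ GD
    (fun e => (uP e).1) (fun e => (uP e).2) _ cP Gloc Aadm err.
  rewrite (_ : (16 * n + 15).+1 = 16 * n.+1)%N; last by lia.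
  set N := (16 * n.+1)%N => low.
  have {}low : (N%:R - n%:R) * (c0 / N%:R ^+ r.+1) ^+ 2 <= eps ^+ 2.
    by apply: low; [rewrite /N; lia | rewrite divr_ge0 ?exprn_ge0// ltW].
  have -> : (r%:R + 2^-1)^-1 = 2 / (2 * r).+1%:R :> R.
    rewrite -(natr1 (2 * r)) natrM; have := ler0n R r; move: r%:R => x x0; field.
    by apply/eqP; lra.
  apply: le_trans (randP n eps _ _); last 1 first.
  + have N0 : 0 < N%:R :> R by rewrite ltr0n.
    have NP : (N%:R ^+ r.+1) ^+ 2 = N%:R * N%:R ^+ (2 * r).+1 :> R.
      by rewrite -exprM -exprS; congr (_ ^+ _); lia.
    have Nn : N%:R / 2 <= N%:R - n%:R :> R.
      have : 2 * n%:R <= N%:R :> R by rewrite -natrM ler_nat /N; lia.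
      by lra.
    have := le_trans (ler_wpM2r (sqr_ge0 (c0 / N%:R ^+ r.+1)) Nn) low.
    rewrite expr_div_n NP mulrA ler_pdivrMr ?mulr_gt0 ?exprn_gt0// => {}low.
    rewrite exprVn mulrAC ler_pdivlMr ?exprn_gt0// mulrC ler_pdivrMr ?exprn_gt0//.
    by rewrite -(ler_pM2l N0); lra.
  + by rewrite ler_wpM2r ?powR_ge0// ge_min lexx.
  + by rewrite e0.
- have [G [c [idx [GD Gu cP Gloc]]]] := fam (16 * n + 15)%N.
  have [u [v uP]] := Gu ua.
  have := quant_error_lower r k q _ n a b D ua A G u idx c _ v eps (ltW ab) GD
    (fun e => (uP e).1) (fun e => (uP e).2) e0 _ cP (fun e e' z => Gloc e e' [::] z isT) Aok err.
  rewrite (_ : (16 * n + 15).+1 = 16 * n.+1)%N; last by lia.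
  set N := (16 * n.+1)%N => low.
  (* Otherwise [quant_error_lower] would give [16 * n.+1 <= 16 * n]. *)
  have {low} low : c0 / N%:R ^+ r.+1 <= 2 * eps.
    by rewrite leNgt; apply/negP => /low; rewrite /N; lia.
  have -> : (r%:R + 1)^-1 = 1 / r.+1%:R :> R by rewrite div1r natr1.
  apply: le_trans (quantP n eps _ _); last 1 first.
  + have NP0 : 0 < N%:R ^+ r.+1 :> R by rewrite exprn_gt0// ltr0n.
    rewrite ler_pdivrMr// in low.
    by rewrite expr1 mulrAC ler_pdivlMr// mulrC ler_pdivrMr//; lra.
  + by rewrite ler_wpM2r ?powR_ge0// ge_min lexx orbT.
  + by rewrite e0.
Qed.
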